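(* Let $q$ be a positive integer and let $\sigma\in\mathrm{Aut}\,\mathcal{B}(q)$. Then there exist $\mu,\nu\in\mathbb{C}^*$ and $s\in\{\pm1\}$ such that $\sigma(L_{\alpha,i})=s\,\mu^{\alpha}\nu^{i}L_{s\alpha,i}$ for all $\alpha\in\mathbb{Z}$, $i\in\mathbb{Z}_+$. In particular, $\mathrm{Aut}\,\mathcal{B}(q)\cong(\mathbb{C}^*\times\mathbb{C}^* )\rtimes\mathbb{Z}/2\mathbb{Z}$.
   Context: $\mathbb{Z}_+$ denotes the set of nonnegative integers and $\mathbb{C}^*=\mathbb{C}\setminus\{0\}$. For a positive integer $q$, $\mathcal{B}(q)$ is the complex Lie algebra with basis $\{L_{\alpha,i}\mid \alpha\in\mathbb{Z},\ i\in\mathbb{Z}_+\}$ and bracket $[L_{\alpha,i},L_{\beta,j}]=(\beta(i+q)-\alpha(j+q))L_{\alpha+\beta,i+j}$. $\mathrm{Aut}\,\mathcal{B}(q)$ is its group of Lie algebra automorphisms. For $\mu,\nu\in\mathbb{C}^*$ and $s\in\{\pm1\}$, the linear maps $\theta_\mu:L_{\alpha,i}\mapsto\mu^{\alpha}L_{\alpha,i}$, $\eta_\nu:L_{\alpha,i}\mapsto\nu^{i}L_{\alpha,i}$ and $\delta_s:L_{\alpha,i}\mapsto sL_{s\alpha,i}$ are automorphisms of $\mathcal{B}(q)$. In the semidirect product decomposition, the two factors $\mathbb{C}^*$ correspond to the subgroups $\{\theta_\mu\mid\mu\in\mathbb{C}^*\}$ and $\{\eta_\nu\mid\nu\in\mathbb{C}^*\}$,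 and $\mathbb{Z}/2\mathbb{Z}$ corresponds to the subgroup $\{\delta_s\mid s=\pm1\}$, acting by conjugation in $\mathrm{Aut}\,\mathcal{B}(q)$. *)

(* Defs.v *)
From HB Require Import structures.
From mathcomp Require Import all_boot all_order all_algebra all_fingroup.
From mathcomp Require Import finmap.
From mathcomp Require Import boolp reals.
From mathcomp Require Import complex.
From mathcomp Require Import ring.
From mathcomp.multinomials Require Import monalg.

Set Implicit Arguments.
Unset Strict Implicit.
Unset Printing Implicit Defensive.

Import Order.TTheory GRing.Theory Num.Theory.
Local Open Scope ring_scope.

HB.mixin Record Lmodule_isLieAlgebra (K : comNzRingType) L
    of GRing.Lmodule K L := {
  lieb : L -> L -> L;
  lieb_linearl : forall y : L, linear (lieb^~ y);
  lieb_linearr : forall x : L, linear (lieb x);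
  liebxx : forall x : L, lieb x x = 0;
  lieb_jacobi : forall x y z : L,
    lieb x (lieb y z) + lieb y (lieb z x) + lieb z (lieb x y) = 0
}.

#[short(type="lieAlgType")]
HB.structure Definition LieAlgebra (K : comNzRingType) :=
  { L of Lmodule_isLieAlgebra K L & GRing.Lmodule K L }.

Lemma linearZE (K : comNzRingType) (U V : lmodType K) (f : U -> V) :
  linear f -> forall c u, f (c *: u) = c *: f u.
Proof.
move=> fl c u; pose F : {linear U -> V} :=
  HB.pack f (GRing.isLinear.Build _ _ _ _ f fl).
by rewrite -[f]/(F : _ -> _) linearZ.
Qed.

Section LieAut.
Variables (K : comNzRingType) (L : lieAlgType K).

Definition is_lie_aut (f : L -> L) : Prop :=
  [/\ linear f, bijective f & {morph f : x y / lieb x y}].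

Record lieAut : Type := LieAut {
  lieAut_fun :> L -> L;
  lieAut_funP : `[< is_lie_aut lieAut_fun >]
}.

HB.instance Definition _ := [isSub for lieAut_fun].
HB.instance Definition _ := [Choice of lieAut by <:].

Lemma is_lie_autP (f : lieAut) : is_lie_aut f.
Proof. exact/asboolP/(valP f). Qed.

Lemma lieAutZ (f : lieAut) c x : f (c *: x) = c *: f x.
Proof. by have [fl _ _] := is_lie_autP f; apply: linearZE. Qed.

Lemma lieAutP (f g : lieAut) : f =1 g -> f = g.
Proof. by move=> fg; apply/val_inj/funext. Qed.

Definition mk_lieAut f (fP : is_lie_aut f) : lieAut := LieAut (asboolT fP).

Lemma is_lie_aut_id : is_lie_aut id.
Proof. by split => //; exists id. Qed.

Lemma is_lie_aut_comp f g :
  is_lie_aut f -> is_lie_aut g -> is_lie_aut (f \o g).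
Proof.
move=> [fl fb fm] [gl gb gm]; split; last by move=> x y /=; rewrite gm fm.
- by move=> a x y /=; rewrite gl fl.
- exact: bij_comp.
Qed.

Lemma is_lie_aut_inv f g :
  is_lie_aut f -> cancel f g -> cancel g f -> is_lie_aut g.
Proof.
move=> [fl fb fm] fK gK; split.
- by move=> a x y; apply: (can_inj fK); rewrite gK fl !gK.
- by exists f.
- by move=> x y; apply: (can_inj fK); rewrite gK fm !gK.
Qed.

Lemma lieAut_inv_subproof (f : lieAut) :
  exists g : lieAut, cancel f g /\ cancel g f.
Proof.
have [_ [g fK gK] _] := is_lie_autP f.
by exists (mk_lieAut (is_lie_aut_inv (is_lie_autP f) fK gK)).
Qed.

Definition lieAut1 : lieAut := mk_lieAut is_lie_aut_id.
Definition lieAutM (f g : lieAut) : lieAut :=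
  mk_lieAut (is_lie_aut_comp (is_lie_autP f) (is_lie_autP g)).
Definition lieAutV (f : lieAut) : lieAut :=
  projT1 (cid (lieAut_inv_subproof f)).

Lemma lieAutVK (f : lieAut) : cancel f (lieAutV f) /\ cancel (lieAutV f) f.
Proof. exact: projT2 (cid (lieAut_inv_subproof f)). Qed.

Lemma lieAut_mulA : associative lieAutM.
Proof. by move=> f g h; apply: lieAutP. Qed.
Lemma lieAut_mul1 : left_id lieAut1 lieAutM.
Proof. by move=> f; apply: lieAutP. Qed.
Lemma lieAut_mulr1 : right_id lieAut1 lieAutM.
Proof. by move=> f; apply: lieAutP. Qed.
Lemma lieAut_mulV : left_inverse lieAut1 lieAutV lieAutM.
Proof. by move=> f; apply: lieAutP => x; exact: (lieAutVK f).1. Qed.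
Lemma lieAut_mulrV : right_inverse lieAut1 lieAutV lieAutM.
Proof. by move=> f; apply: lieAutP => x; exact: (lieAutVK f).2. Qed.

HB.instance Definition _ := isGroup.Build lieAut
  lieAut_mulA lieAut_mul1 lieAut_mulr1 lieAut_mulV lieAut_mulrV.

Lemma lieAutME (f g : lieAut) x : (f * g)%g x = f (g x).
Proof. by []. Qed.

Lemma lieAut_diag_conj (D T E T' E' : lieAut) (u v : L) (s t e t' : K) :
  D u = s *: v -> T u = t *: u -> E u = e *: u ->
  T' v = t' *: v -> E' v = e *: v -> t = t' ->
  (D * (T * E))%g u = (T' * E' * D)%g u.
Proof.
move=> Du Tu Eu T'v E'v tt'.
rewrite !lieAutME Eu lieAutZ Tu !lieAutZ Du !lieAutZ E'v lieAutZ T'v !scalerA.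
by rewrite tt'; congr (_ *: _); rewrite mulrC mulrA mulrAC.
Qed.

End LieAut.

(* The multiplicative group K^* of a field. *)
Section FieldUnits.
Variable K : fieldType.

Record fieldUnits : Type := FieldUnits {
  fuval :> K;
  fuvalP : fuval != 0
}.

HB.instance Definition _ := [isSub for fuval].
HB.instance Definition _ := [Choice of fieldUnits by <:].

Definition fu1 : fieldUnits := FieldUnits (oner_neq0 K).
Definition fuM (x y : fieldUnits) : fieldUnits :=
  FieldUnits (mulf_neq0 (fuvalP x) (fuvalP y)).
Lemma fuV_subproof (x : fieldUnits) : (x : K)^-1 != 0.
Proof. by rewrite invr_eq0 fuvalP. Qed.
Definition fuV (x : fieldUnits) : fieldUnits := FieldUnits (fuV_subproof x).

Lemma fu_mulA : associative fuM.
Proof. by move=> x y z; apply: val_inj; apply: mulrA. Qed.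
Lemma fu_mul1 : left_id fu1 fuM.
Proof. by move=> x; apply: val_inj; apply: mul1r. Qed.
Lemma fu_mulr1 : right_id fu1 fuM.
Proof. by move=> x; apply: val_inj; apply: mulr1. Qed.
Lemma fu_mulV : left_inverse fu1 fuV fuM.
Proof. by move=> x; apply: val_inj; apply: mulVf; apply: fuvalP. Qed.
Lemma fu_mulrV : right_inverse fu1 fuV fuM.
Proof. by move=> x; apply: val_inj; apply: mulfV; apply: fuvalP. Qed.

HB.instance Definition _ := isGroup.Build fieldUnits
  fu_mulA fu_mul1 fu_mulr1 fu_mulV fu_mulrV.

Lemma fuvalM (x y : fieldUnits) : fuval (x * y)%g = fuval x * fuval y.
Proof. by []. Qed.
Lemma fuvalV (x : fieldUnits) : fuval (x^-1)%g = (fuval x)^-1.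
Proof. by []. Qed.
Lemma fuval1 : fuval (1%g : fieldUnits) = 1.
Proof. by []. Qed.

End FieldUnits.

(* External semidirect product N ><| H of possibly infinite groups. *)
Section SemidirectProduct.
Variables (N H : groupType).
Local Open Scope group_scope.

Record autAction : Type := AutAction {
  aact :> H -> N -> N;
  aactM : forall h, {morph aact h : x y / x * y};
  aact1 : forall x, aact 1 x = x;
  aactA : forall h k x, aact (h * k) x = aact h (aact k x)
}.

Definition semidirect (phi : autAction) : Type := (N * H)%type.

Variable phi : autAction.

HB.instance Definition _ := Choice.on (semidirect phi).

Definition sd1 : semidirect phi := (1, 1).
Definition sdM (u v : semidirect phi) : semidirect phi :=
  (u.1 * phi u.2 v.1, u.2 * v.2).
Definition sdV (u : semidirect phi) : semidirect phi :=
  (phi u.2^-1 u.1^-1, u.2^-1).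

Lemma aactg1 h : phi h 1 = 1.
Proof. by apply: (@mulgI _ (phi h 1)); rewrite -aactM !mulg1. Qed.

Lemma sd_mulA : associative sdM.
Proof.
by move=> [x h] [y k] [z l]; rewrite /sdM /= aactM aactA !mulgA.
Qed.
Lemma sd_mul1 : left_id sd1 sdM.
Proof. by move=> [x h]; rewrite /sdM /= aact1 !mul1g. Qed.
Lemma sd_mulr1 : right_id sd1 sdM.
Proof. by move=> [x h]; rewrite /sdM /= aactg1 !mulg1. Qed.
Lemma sd_mulV : left_inverse sd1 sdV sdM.
Proof. by move=> [x h]; rewrite /sdM /= -aactM !mulVg aactg1. Qed.
Lemma sd_mulrV : right_inverse sd1 sdV sdM.
Proof. by move=> [x h]; rewrite /sdM /= -aactA !mulgV aact1 mulgV. Qed.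

HB.instance Definition _ := isGroup.Build (semidirect phi)
  sd_mulA sd_mul1 sd_mulr1 sd_mulV sd_mulrV.

End SemidirectProduct.

Definition group_isomorphism (G H : groupType) (f : G -> H) : Prop :=
  {morph f : x y / (x * y)%g} /\ bijective f.

(* The linear map out of the free module {malg K[I]} sending << i >> to h i. *)
HB.lock Definition linext (K : comNzRingType) (I : choiceType) (V : lmodType K)
    (h : I -> V) (g : {malg K[I]}) : V :=
  \sum_(i <- msupp g) g@_i *: h i.

Section LinearExtension.
Variables (K : comNzRingType) (I : choiceType) (V : lmodType K).
Implicit Types (h : I -> V) (g : {malg K[I]}).

Lemma linextEw h (d : {fset I}) g :
  (msupp g `<=` d)%fset -> linext h g = \sum_(i <- d) g@_i *: h i.
Proof.
move=> sub; rewrite linext.unlock (big_fset_incl _ sub) // => i _ /mcoeff_outdom ->.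
by rewrite scale0r.
Qed.

Lemma linext_linear h : linear (linext h).
Proof.
move=> a x y; set d := (msupp x `|` msupp y)%fset.
have sxy : (msupp (a *: x + y) `<=` d)%fset.
  apply: fsubset_trans (msuppD_le _ _) _; apply: fsetUSS => //.
  exact: msuppZ_le.
rewrite (linextEw h sxy) (@linextEw h d x) ?fsubsetUl //.
rewrite (@linextEw h d y) ?fsubsetUr // scaler_sumr -big_split /=.
by apply: eq_bigr => i _; rewrite mcoeffD mcoeffZ scalerDl scalerA.
Qed.

Lemma linext_comb a h1 h2 h g : (forall i, h i = a *: h1 i + h2 i) ->
  linext h g = a *: linext h1 g + linext h2 g.
Proof.
move=> hE; rewrite linext.unlock scaler_sumr -big_split /=.
by apply: eq_bigr => i _; rewrite hE scalerDr !scalerA [a * _]mulrC.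
Qed.

Lemma linextU h i : linext h << i >> = h i.
Proof. by rewrite linext.unlock msuppU oner_eq0 big_seq_fset1 mcoeffUU scale1r. Qed.

Lemma malg_linear_ext (f g : {malg K[I]} -> V) :
  linear f -> linear g -> (forall i, f << i >> = g << i >>) -> f =1 g.
Proof.
move=> fl gl fg x.
pose F := GRing.isLinear.Build _ _ _ _ f fl.
pose G := GRing.isLinear.Build _ _ _ _ g gl.
pose F' : {linear _ -> _} := HB.pack f F.
pose G' : {linear _ -> _} := HB.pack g G.
rewrite [x]monalgE -[f]/(F' : _ -> _) -[g]/(G' : _ -> _) !raddf_sum /=.
apply: eq_bigr => i _.
have -> : << x@_i *g i >> = x@_i *: << i >> :> {malg K[I]}.
  by apply/malgP => k; rewrite mcoeffZ !mcoeffU mulrnAr mulr1.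
by rewrite -[f _]/(F' _) -[g _]/(G' _) !linearZ /= fg.
Qed.

End LinearExtension.

Section Jacobiator.
Variables (K : comNzRingType) (V : lmodType K) (br : V -> V -> V).
Hypotheses (brl : forall y, linear (br^~ y)) (brr : forall x, linear (br x)).

Definition jacobiator (x y z : V) : V :=
  br x (br y z) + br y (br z x) + br z (br x y).

Lemma jacobiator_linear :
  [/\ forall y z, linear (fun x => jacobiator x y z),
      forall x z, linear (fun y => jacobiator x y z)
    & forall x y, linear (jacobiator x y)].
Proof.
have lE c u v w : br (c *: u + v) w = c *: br u w + br v w by exact: brl.
have rE c u v w : br w (c *: u + v) = c *: br w u + br w v by exact: brr.
have Jx y z : linear (fun x => jacobiator x y z).
  move=> c u v; rewrite /jacobiator !(lE, rE) !scalerDr.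
  by rewrite (addrACA (c *: _)) (addrACA (c *: _ + _)).
have JC x y z : jacobiator x y z = jacobiator y z x.
  by rewrite /jacobiator [RHS]addrC addrA.
have JC2 x y z : jacobiator x y z = jacobiator z x y by rewrite -(JC z).
by split=> // x y c u v; [rewrite !(JC x) Jx | rewrite !(JC2 x) Jx].
Qed.

End Jacobiator.

(* B(q): L_{a,i} is the basis vector << (a, i) >> of the free module on
   int * nat.  The carrier does not depend on q; q selects the bracket. *)
Definition block (K : numFieldType) (q : nat) : Type :=
  {malg K[(int * nat)%type]}.

HB.instance Definition _ (K : numFieldType) (q : nat) :=
  GRing.Lmodule.on (block K q).

Section Block.
Variables (K : numFieldType) (q : nat).
Local Notation block := (block K q).

Definition blockL (a : int) (i : nat) : block := << (a, i) >>.

Definition block_bracket (x y : block) : block :=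
  linext (fun k => linext (fun l =>
    (l.1 * (k.2 + q)%N%:Z - k.1 * (l.2 + q)%N%:Z)%:~R *:
      blockL (k.1 + l.1) (k.2 + l.2)%N) y) x.

Lemma block_bracketLL a i b j :
  block_bracket (blockL a i) (blockL b j) =
  (b * (i + q)%N%:Z - a * (j + q)%N%:Z)%:~R *: blockL (a + b) (i + j)%N.
Proof. by rewrite /block_bracket !linextU. Qed.

Lemma block_bracket_linearl y : linear (block_bracket^~ y).
Proof. exact: linext_linear. Qed.

Lemma block_bracket_linearr x : linear (block_bracket x).
Proof.
by move=> a y z; apply: linext_comb => k; exact: linext_linear.
Qed.

Lemma block_bracketLLL a i b j c k :
  block_bracket (blockL a i) (block_bracket (blockL b j) (blockL c k)) =
  ((c * (j + q)%N%:Z - b * (k + q)%N%:Z) *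
   ((b + c) * (i + q)%N%:Z - a * ((j + k)%N + q)%N%:Z))%:~R *:
    blockL (a + (b + c)) (i + (j + k))%N.
Proof.
rewrite (block_bracketLL b j c k) (linearZE (block_bracket_linearr _)).
by rewrite block_bracketLL scalerA -rmorphM.
Qed.

Lemma block_ext (V : lmodType K) (f g : block -> V) :
  linear f -> linear g -> (forall a i, f (blockL a i) = g (blockL a i)) ->
  f =1 g.
Proof. by move=> fl gl fg; apply: malg_linear_ext => // -[a i]; apply: fg. Qed.

Lemma block_bracketC x y : block_bracket x y = - block_bracket y x.
Proof.
have oppl (f : block -> block) : linear f -> linear (fun z => - f z).
  by move=> fl c u v; rewrite fl opprD scalerN.
apply: (@block_ext _ (block_bracket^~ y) (fun z => - block_bracket y z)).
- exact: block_bracket_linearl.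
- by apply: oppl; apply: block_bracket_linearr.
move=> a i.
apply: (@block_ext _ (block_bracket _) (fun z => - block_bracket z _)).
- exact: block_bracket_linearr.
- by apply: oppl; apply: block_bracket_linearl.
move=> b j; rewrite !block_bracketLL -scaleNr -rmorphN opprB.
by rewrite [a + b]addrC [(i + j)%N]addnC.
Qed.

Lemma block_bracketxx x : block_bracket x x = 0.
Proof.
have /eqP := block_bracketC x x.
rewrite -addr_eq0 -mulr2n -scaler_nat scaler_eq0 pnatr_eq0 /=.
by move/eqP.
Qed.

Lemma block_bracket_jacobi x y z :
  block_bracket x (block_bracket y z) + block_bracket y (block_bracket z x) +
  block_bracket z (block_bracket x y) = 0.
Proof.
have l0 : linear (fun _ : block => 0 : block).
  by move=> c u v; rewrite scaler0 addr0.
have [Jx Jy Jz] :=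
  jacobiator_linear block_bracket_linearl block_bracket_linearr.
rewrite -/(jacobiator block_bracket x y z).
move: x; apply: (block_ext (Jx y z) l0) => a i.
move: y; apply: (block_ext (Jy _ z) l0) => b j.
move: z; apply: (block_ext (Jz _ _) l0) => c k.
rewrite /jacobiator !block_bracketLLL.
have -> : b + (c + a) = a + (b + c) by rewrite addrA addrC.
have -> : c + (a + b) = a + (b + c) by rewrite addrC -addrA.
have -> : (j + (k + i) = i + (j + k))%N by rewrite addnA addnC.
have -> : (k + (i + j) = i + (j + k))%N by rewrite addnC -addnA.
rewrite -!scalerDl -!rmorphD /= [X in X%:~R](_ : _ = 0) ?scale0r //.
rewrite !PoszD; ring.
Qed.

HB.instance Definition _ := Lmodule_isLieAlgebra.Build K block
  block_bracket_linearl block_bracket_linearr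
  block_bracketxx block_bracket_jacobi.

End Block.

Arguments blockL {K q} a i.

Section BlockAutomorphisms.
Variables (K : numFieldType) (q : nat).
Local Notation block := (block K q).
Local Notation Kstar := (fieldUnits K).

Definition theta_fun (mu : K) : block -> block :=
  linext (fun k => mu ^ k.1 *: blockL k.1 k.2).

Definition eta_fun (nu : K) : block -> block :=
  linext (fun k => nu ^+ k.2 *: blockL k.1 k.2).

Definition delta_fun (s : int) : block -> block :=
  linext (fun k => s%:~R *: blockL (s * k.1) k.2).

Lemma theta_funL mu a i : theta_fun mu (blockL a i) = mu ^ a *: blockL a i.
Proof. exact: linextU. Qed.

Lemma eta_funL nu a i : eta_fun nu (blockL a i) = nu ^+ i *: blockL a i.
Proof. exact: linextU. Qed.

Lemma delta_funL s a i :
  delta_fun s (blockL a i) = s%:~R *: blockL (s * a) i.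
Proof. exact: linextU. Qed.

Lemma lieb_blockL a i b j : lieb (blockL a i : block) (blockL b j) =
  (b * (i + q)%N%:Z - a * (j + q)%N%:Z)%:~R *: blockL (a + b) (i + j)%N.
Proof. exact: block_bracketLL. Qed.

Lemma lieb_blockZ (c d : K) (u v : block) :
  lieb (c *: u) (d *: v) = (c * d) *: lieb u v.
Proof.
rewrite (linearZE (@lieb_linearr _ block (c *: u))).
by rewrite (linearZE (@lieb_linearl _ block v)) scalerA mulrC.
Qed.

Lemma block_autP (f g : block -> block) : linear f -> linear g ->
  (forall a i, g (f (blockL a i)) = blockL a i) ->
  (forall a i, f (g (blockL a i)) = blockL a i) ->
  (forall a i b j, f (lieb (blockL a i) (blockL b j)) =
     lieb (f (blockL a i)) (f (blockL b j))) ->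
  is_lie_aut f.
Proof.
move=> fl gl fK gK fm; split=> //.
  by exists g; apply: block_ext => // c u v; rewrite ?(fl, gl) ?(fl, gl).
move=> x y; move: x.
apply: (@block_ext _ _ _ (fun x => f (lieb x y)) (fun x => lieb (f x) (f y))).
- by move=> c u v; rewrite lieb_linearl fl.
- by move=> c u v; rewrite fl lieb_linearl.
move=> a i; move: y; apply: (@block_ext _ _ _ (fun y => f (lieb _ y))
  (fun y => lieb (f _) (f y))).
- by move=> c u v; rewrite lieb_linearr fl.
- by move=> c u v; rewrite fl lieb_linearr.
exact: fm.
Qed.

Lemma theta_lie_aut (mu : Kstar) : is_lie_aut (theta_fun (fuval mu)).
Proof.
have tl nu : linear (theta_fun nu) by exact: linext_linear.
apply: (block_autP (tl _) (tl (fuval mu)^-1)) => [a i|a i|a i b j].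
- rewrite theta_funL (linearZE (tl _)) theta_funL scalerA exprz_inv -invr_expz.
  by rewrite mulfV ?scale1r // expfz_neq0 ?fuvalP.
- rewrite theta_funL (linearZE (tl _)) theta_funL scalerA exprz_inv -invr_expz.
  by rewrite mulVf ?scale1r // expfz_neq0 ?fuvalP.
rewrite lieb_blockL (linearZE (tl _)) !theta_funL lieb_blockZ lieb_blockL.
rewrite !scalerA.
by rewrite (expfzDr _ _ (fuvalP mu)) mulrC.
Qed.

Lemma eta_lie_aut (nu : Kstar) : is_lie_aut (eta_fun (fuval nu)).
Proof.
have tl c : linear (eta_fun c) by exact: linext_linear.
apply: (block_autP (tl _) (tl (fuval nu)^-1)) => [a i|a i|a i b j].
- rewrite eta_funL (linearZE (tl _)) eta_funL scalerA exprVn.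
  by rewrite mulfV ?scale1r // expf_neq0 ?fuvalP.
- rewrite eta_funL (linearZE (tl _)) eta_funL scalerA exprVn.
  by rewrite mulVf ?scale1r // expf_neq0 ?fuvalP.
rewrite lieb_blockL (linearZE (tl _)) !eta_funL lieb_blockZ lieb_blockL.
rewrite !scalerA.
by rewrite exprD mulrC.
Qed.

Lemma delta_lie_aut (s : int) : s * s = 1 -> is_lie_aut (delta_fun s).
Proof.
move=> ss; have tl c : linear (delta_fun c) by exact: linext_linear.
have dK a i : delta_fun s (delta_fun s (blockL a i)) = blockL a i.
  rewrite delta_funL (linearZE (tl _)) delta_funL scalerA mulrA ss mul1r.
  by rewrite -intrM ss scale1r.
apply: (block_autP (tl s) (tl s) dK dK) => a i b j.
rewrite lieb_blockL (linearZE (tl _)) !delta_funL lieb_blockZ lieb_blockL.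
rewrite !scalerA.
rewrite [s * (a + b)]mulrDr -!intrM ss mul1r.
have -> : s * b * (i + q)%N%:Z - s * a * (j + q)%N%:Z =
  (b * (i + q)%N%:Z - a * (j + q)%N%:Z) * s by ring.
reflexivity.
Qed.

Definition theta (mu : Kstar) : lieAut block := mk_lieAut (theta_lie_aut mu).
Definition eta (nu : Kstar) : lieAut block := mk_lieAut (eta_lie_aut nu).

(* 'Z_2 is identified with {1, -1} by k |-> (-1) ^+ k. *)
Definition sgnZ2 (k : 'Z_2) : int := (-1) ^+ k.

Lemma sgnZ2_sqr k : sgnZ2 k * sgnZ2 k = 1.
Proof. by rewrite /sgnZ2 -expr2 -exprM mulnC exprM sqrrN expr1n. Qed.

Definition delta (k : 'Z_2) : lieAut block :=
  mk_lieAut (delta_lie_aut (sgnZ2_sqr k)).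

Lemma thetaL mu a i : theta mu (blockL a i) = fuval mu ^ a *: blockL a i.
Proof. exact: theta_funL. Qed.

Lemma etaL nu a i : eta nu (blockL a i) = fuval nu ^+ i *: blockL a i.
Proof. exact: eta_funL. Qed.

Lemma deltaL k a i :
  delta k (blockL a i) = (sgnZ2 k)%:~R *: blockL (sgnZ2 k * a) i.
Proof. exact: delta_funL. Qed.

Definition block_act_fun (k : 'Z_2) (x : Kstar * Kstar) : Kstar * Kstar :=
  (if k == 0 then x.1 else (x.1^-1)%g, x.2).

Lemma block_actM k : {morph block_act_fun k : x y / (x * y)%g}.
Proof.
move=> [x1 x2] [y1 y2]; rewrite /block_act_fun /=; case: ifP => // _.
congr (_, _); apply: val_inj => /=; rewrite invfM //.
Qed.

Lemma block_act1 x : block_act_fun 1%g x = x.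
Proof. by case: x. Qed.

Lemma block_actA (k l : 'Z_2) x :
  block_act_fun (k * l)%g x = block_act_fun k (block_act_fun l x).
Proof.
by case: x => x1 x2; case: k => [[|[|//]] ?]; case: l => [[|[|//]] ?];
   rewrite /block_act_fun //= ?invgK.
Qed.

(* The action of 'Z_2 on K^* * K^* induced by conjugation by delta on the
   automorphisms theta mu * eta nu, see block_act_conj. *)
Definition block_act : autAction (Kstar * Kstar)%type 'Z_2 :=
  AutAction block_actM block_act1 block_actA.

Lemma block_act_conj (k : 'Z_2) (x : Kstar * Kstar) :
  (delta k * (theta x.1 * eta x.2) * (delta k)^-1)%g =
  (theta (block_act k x).1 * eta (block_act k x).2)%g.
Proof.
apply: (@mulIg _ (delta k)); rewrite mulgVK; apply: lieAutP.
apply: block_ext => [||a i].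
- by have [] := is_lie_autP (delta k * (theta x.1 * eta x.2))%g.
- by have [] := is_lie_autP
    (theta (block_act k x).1 * eta (block_act k x).2 * delta k)%g.
apply: (lieAut_diag_conj (deltaL k a i) (thetaL x.1 a i) (etaL x.2 a i)
  (thetaL (block_act k x).1 (sgnZ2 k * a) i)
  (etaL (block_act k x).2 (sgnZ2 k * a) i)).
case: x k => x1 x2 [[|[|//]] klt]; rewrite /sgnZ2.
  by rewrite expr0 mul1r.
rewrite expr1 mulN1r; change (fuval x1 ^ a = (fuval x1)^-1 ^ (- a)).
by rewrite exprz_inv opprK.
Qed.

End BlockAutomorphisms.

Arguments theta {K} q mu.
Arguments eta {K} q nu.
Arguments delta K q k : clear implicits.

(* Main.v *)
From HB Require Import structures.
Require Import Defs.
From mathcomp Require Import all_boot all_order all_algebra all_fingroup.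
From mathcomp Require Import reals complex.
From mathcomp Require Import finmap boolp zify ring.
From mathcomp.multinomials Require Import monalg.

Set Implicit Arguments.
Unset Strict Implicit.
Unset Printing Implicit Defensive.

Import Order.TTheory GRing.Theory Num.Theory.
Local Open Scope ring_scope.

(** Write B_a for the span of the L_{a,i} with a fixed.  The proof pins down an
    automorphism sigma in three stages, over a field K of characteristic 0.

    The line K L_{0,0} is intrinsic: it is the set of the x whose adjoint action
    is locally finite, i.e. such that the iterates of ad x on any vector stay in
    a finite-dimensional subspace.  Indeed ad L_{0,0} acts on B_a as the scalar
    a q, while if x has a leading term L_{a,i} other than L_{0,0} for the
    lexicographic order, then iterating ad x on a well chosen basis vector
    produces ever new leading terms ([not_ad_locally_finite]).  Hence
    sigma L_{0,0} = c L_{0,0}, and comparing the eigenvalues of ad L_{0,0},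
    which are the integer multiples of q, for sigma and for its inverse gives
    c = 1 or c = -1 ([aut_L00]).

    After composition with delta, c = 1, so sigma preserves each eigenspace B_a.
    Identify B_a with K[X] by sending L_{a,i} to X^i, and put
    D f = q f + X f'.  The bracket of f in B_a with g in B_b becomes
    b (D f) g - a f (D g) in B_{a+b} ([lieb_poly_block]), so sigma turns into a
    family of linear maps A_a on K[X] compatible with that formula.  Bracketing
    1 in B_a with 1 in B_{-a} shows that A_a 1 and A_{-a} 1 are inverse
    polynomials, hence constants.  Bracketing 1 and X in B_1 and B_{-1} gives a
    linear differential equation for A_0 X whose only polynomial solutions are
    the scalar multiples nu X.  Bracketing with X in B_0 and in B_1 then
    determines everything: A_a X^i = mu^a nu^i X^i ([poly_aut_normal_form]).

    Finally, the map sending ((mu, nu), k) to theta mu * eta nu * delta k is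
    surjective by this normal form, and its injectivity and multiplicativity are
    read off from the images of the basis vectors ([aut_of_iso]). *)

(** * Linear maps on a free module *)

Lemma linear_expand (K : comNzRingType) (I : choiceType) (V : lmodType K)
    (f : {malg K[I]} -> V) (x : {malg K[I]}) :
  linear f -> f x = \sum_(k <- msupp x) x@_k *: f << k >>.
Proof.
move=> fl; rewrite (malg_linear_ext fl (linext_linear (fun k => f << k >>))).
  by rewrite linext.unlock.
by move=> k; rewrite linextU.
Qed.

Lemma linear_coeff_neq0 (K : comNzRingType) (I J : choiceType)
    (f : {malg K[I]} -> {malg K[J]}) (x : {malg K[I]}) (m : J) :
  linear f -> (f x)@_m != 0 -> exists2 k, x@_k != 0 & (f << k >>)@_m != 0.
Proof.
move=> fl; rewrite (linear_expand x fl) raddf_sum /= => nz.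
have [/hasP[k kx fk]|/hasPn h] :=
  boolP (has (fun k => (f << k >>)@_m != 0) (msupp x)).
  by exists k => //; rewrite mcoeff_neq0.
case/eqP: nz; rewrite big_seq big1 // => k kx.
by rewrite mcoeffZ; have /negPn/eqP -> := h k kx; rewrite mulr0.
Qed.

(** * Ad-locally finite elements *)

Lemma seq_inj_infinite (T : eqType) (f : nat -> T) (s : seq T) :
  injective f -> ~ (forall n, f n \in s).
Proof.
move=> fi fs.
have u : uniq (map f (iota 0 (size s).+1)) by rewrite map_inj_uniq ?iota_uniq.
have /(uniq_leq_size u) : {subset map f (iota 0 (size s).+1) <= s}.
  by move=> _ /mapP[n _ ->].
by rewrite size_map size_iota ltnn.
Qed.

Definition lexle (k l : int * nat) : bool :=
  (k.1 < l.1) || (k.1 == l.1) && (k.2 <= l.2)%N.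

Lemma lexlexx k : lexle k k.
Proof. by rewrite /lexle eqxx leqnn orbT. Qed.

Lemma lexle_max (s : seq (int * nat)) : s != [::] ->
  exists2 p, p \in s & {in s, forall p', lexle p' p}.
Proof.
elim: s => // k s IH _; have [->|/IH[p ps pM]] := eqVneq s [::].
  exists k; rewrite ?inE // => l; rewrite inE => /eqP ->.
  by rewrite lexlexx.
have [kp|pk] := boolP (lexle k p).
  by exists p => [|l]; rewrite inE ?ps ?orbT // => /orP[/eqP->|/pM].
exists k => [|l]; rewrite inE ?eqxx // => /orP[/eqP->|/pM].
  by rewrite lexlexx.
by move: pk; rewrite /lexle; lia.
Qed.

Section LocallyFinite.
Variables (K : numFieldType) (q : nat).
Hypothesis q_gt0 : (0 < q)%N.
Local Notation block := (block K q).
Implicit Types (x y : block) (p k l m : int * nat).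

Definition lead x p : Prop :=
  x@_p != 0 /\ forall p', x@_p' != 0 -> lexle p' p.

Definition addix k l : int * nat := (k.1 + l.1, (k.2 + l.2)%N).

Definition struct_coef k l : int := l.1 * (k.2 + q)%N%:Z - k.1 * (l.2 + q)%N%:Z.

Lemma lieb_coeff x y m : (lieb x y : block)@_m =
  \sum_(k <- msupp x) \sum_(l <- msupp y)
    x@_k * (y@_l * ((struct_coef k l)%:~R * (addix k l == m)%:R)).
Proof.
rewrite [lieb x y]/(block_bracket x y) /block_bracket linext.unlock raddf_sum /=.
apply: eq_bigr => k _; rewrite mcoeffZ raddf_sum mulr_sumr /=.
by apply: eq_bigr => l _; rewrite !mcoeffZ mcoeffU mulrA.
Qed.

(** As the order is compatible with addition of indices, the index p + r is
    reached only by the two leading terms, so that nothing can cancel it. *)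
Lemma lead_lieb x y p r : lead x p -> lead y r -> struct_coef p r != 0 ->
  lead (lieb x y) (addix p r).
Proof.
move=> [xp xM] [yr yM] c0; split.
  rewrite lieb_coeff (big_fsetD1 p) -?mcoeff_neq0 //.
  rewrite (big_fsetD1 r (A := msupp y)) -?mcoeff_neq0 //=.
  rewrite eqxx mulr1 big_seq big1 ?addr0 => [|l].
    rewrite big_seq big1 ?addr0 ?mulf_neq0 ?intr_eq0 // => k.
    rewrite !inE => /andP[kp kx]; rewrite big_seq big1 // => l ly.
    rewrite -!mcoeff_neq0 in kx ly; have := xM _ kx; have := yM _ ly.
    case: eqP => [|_ _ _]; last by rewrite !mulr0.
    case: k l p r kp {kx ly xp yr xM yM c0} => [k1 k2] [l1 l2] [p1 p2] [r1 r2].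
    rewrite /addix /lexle /= xpair_eqE => ? [? ?] ? ?; lia.
  rewrite !inE => /andP[lr ly]; rewrite -mcoeff_neq0 in ly; have := yM _ ly.
  case: eqP => [|_ _]; last by rewrite !mulr0.
  case: l p r lr {ly xp yr xM yM c0} => [l1 l2] [p1 p2] [r1 r2].
  rewrite /addix /lexle /= xpair_eqE => ? [? ?] ?; lia.
move=> m; have [/hasP[k kx /hasP[l ly /eqP <-]] _|h] := boolP
    (has (fun k => has (fun l => addix k l == m) (msupp y)) (msupp x)).
  rewrite -!mcoeff_neq0 in kx ly; have := xM _ kx; have := yM _ ly.
  by rewrite /lexle /addix /=; lia.
rewrite lieb_coeff big_seq big1 ?eqxx // => k kx; rewrite big_seq big1 // => l ly.
move: h => /hasPn/(_ k kx)/hasPn/(_ l ly)/negPf ->; by rewrite !mulr0.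
Qed.

(** Local finiteness, phrased with supports: the iterates of ad x on y involve
    only finitely many basis vectors, i.e. they span a space of finite
    dimension. *)
Definition ad_locally_finite x : Prop :=
  forall y, exists s : seq (int * nat),
    forall n m, (iter n (lieb x) y : block)@_m != 0 -> m \in s.

Lemma ad_locally_finite_aut (sigma : lieAut block) x :
  ad_locally_finite x -> ad_locally_finite (sigma x).
Proof.
have [sl [tau sK tK] sm] := is_lie_autP sigma.
move=> xf y; have [s sP] := xf (tau y).
exists (flatten [seq enum_fset (msupp (sigma << k >>)) | k <- s]) => n m.
have -> : iter n (lieb (sigma x)) y = sigma (iter n (lieb x) (tau y)).
  by elim: n => [|n /= ->]; rewrite /= ?tK ?sm.
move=> /(linear_coeff_neq0 sl)[k /sP ks km].
by apply/flatten_mapP; exists k => //; rewrite -mcoeff_neq0.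
Qed.

Lemma lieb_L00 y m : (lieb (blockL 0 0 : block) y)@_m = (m.1 * q)%:~R * y@_m.
Proof.
have fl : linear (fun y => (lieb (blockL 0 0 : block) y)@_m : K^o).
  by move=> c u v; rewrite lieb_linearr mcoeffD mcoeffZ.
have gl : linear (fun y : block => (m.1 * q)%:~R * y@_m : K^o).
  by move=> c u v; rewrite mcoeffD mcoeffZ mulrDr mulrCA.
apply: (block_ext fl gl) => a i; rewrite lieb_blockL mcoeffZ !mcoeffU.
rewrite mul0r subr0 add0r add0n.
by case: eqP => [<-|]; rewrite ?mulr0.
Qed.

Lemma ad_locally_finite_L00 : ad_locally_finite (blockL 0 0).
Proof.
move=> y; exists (enum_fset (msupp y)) => n m.
have -> : (iter n (lieb (blockL 0 0 : block)) y)@_m = (m.1 * q)%:~R ^+ n * y@_m.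
  by elim: n => [|n /= IH]; rewrite ?mul1r //= lieb_L00 IH mulrA -exprS.
by rewrite mulf_eq0 negb_or => /andP[_]; rewrite -mcoeff_neq0.
Qed.

Lemma lead_blockL a i : lead (blockL a i) (a, i).
Proof.
split=> [|r]; rewrite mcoeffU ?eqxx ?oner_eq0 //.
have [<-|_] := eqVneq (a, i) r; first by rewrite lexlexx.
by rewrite mulr0n eqxx.
Qed.

(** The structure constant of L_{a,i} with L_{b,j} for (b, j) = (a+1 + n a, n i)
    is (a+1) i + q (1 + n a), which is positive when a >= 0.  Starting from
    L_{a+1,0}, no iterate of ad x therefore loses its leading term, whose index
    (a+1 + n a, n i) takes infinitely many values. *)
Lemma not_ad_locally_finite x p : lead x p -> 0 <= p.1 -> p != (0, 0%N) ->
  ~ ad_locally_finite x.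
Proof.
case: p => a i xp /= a0 pn /(_ (blockL (a + 1) 0)) [s sP].
pose f n : int * nat := (a + 1 + n%:Z * a, (n * i)%N).
have fl n : lead (iter n (lieb x) (blockL (a + 1) 0)) (f n).
  elim: n => [|n IH] /=.
    by rewrite /f mul0r addr0 mul0n; apply: lead_blockL.
  have -> : f n.+1 = addix (a, i) (f n) by rewrite /f /addix /=; congr (_, _); lia.
  by apply: lead_lieb => //; rewrite /struct_coef /=; nia.
apply: (@seq_inj_infinite _ f s) => [m n|n]; last by apply: (sP n); case: (fl n).
move: pn; rewrite xpair_eqE => ai [].
by nia.
Qed.

End LocallyFinite.

(** * The image of L_{0,0} *)

Section ImageL00.
Variables (K : numFieldType) (q : nat).
Hypothesis q_gt0 : (0 < q)%N.
Local Notation block := (block K q).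
Implicit Types (x y : block) (sigma : lieAut block).

Lemma delta_coeff k x a i :
  (delta K q k x)@_(sgnZ2 k * a, i) = (sgnZ2 k)%:~R * x@_(a, i).
Proof.
have [dl _ _] := is_lie_autP (delta K q k).
have fl : linear (fun x : block => (delta K q k x)@_(sgnZ2 k * a, i) : K^o).
  by move=> c u v; rewrite dl mcoeffD mcoeffZ.
have gl : linear (fun x : block => (sgnZ2 k)%:~R * x@_(a, i) : K^o).
  by move=> c u v; rewrite mcoeffD mcoeffZ mulrDr mulrCA.
apply: (block_ext fl gl) => b j; rewrite deltaL mcoeffZ !mcoeffU.
have sI : injective ( *%R (sgnZ2 k)).
  by apply: (can_inj (g := *%R (sgnZ2 k))) => z; rewrite mulrA sgnZ2_sqr mul1r.
by rewrite !xpair_eqE (inj_eq sI).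
Qed.

Lemma ad_locally_finite_lexle x p :
  ad_locally_finite x -> x@_p != 0 -> lexle p (0, 0%N).
Proof.
move=> xf xp; have [|r rx rM] := @lexle_max (enum_fset (msupp x)).
  by apply/eqP => s0; move: xp; rewrite mcoeff_neq0 -[_ \in _]/(p \in enum_fset _) s0.
have rl : lead x r.
  by split=> [|p' xp']; [rewrite mcoeff_neq0 | apply: rM; rewrite -mcoeff_neq0].
have rp : lexle p r by apply: rl.2.
case: (boolP (r == (0, 0%N))) rp => [/eqP -> //|r0].
have [/(not_ad_locally_finite q_gt0 rl)/(_ r0)/(_ xf) //|] := boolP (0 <= r.1).
by rewrite /lexle /=; lia.
Qed.

(** The leading index bounds the support from above only; the lower bound comes
    from the same argument applied after the automorphism that reverses the
    sign of the first index. *)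
Lemma ad_locally_finiteP x :
  ad_locally_finite x -> x = x@_(0, 0%N) *: blockL 0 0.
Proof.
move=> xf; apply/malgP => -[a i]; rewrite mcoeffZ mcoeffU.
have [[<- <-]|n0] := eqVneq (0, 0%N) (a, i); first by rewrite mulr1.
rewrite mulr0; apply/eqP; apply/negPn/negP => xp.
have yf := ad_locally_finite_aut (delta K q 1) xf.
have := ad_locally_finite_lexle xf xp.
have /(ad_locally_finite_lexle yf) : (delta K q 1 x)@_(sgnZ2 1 * a, i) != 0.
  by rewrite delta_coeff mulf_neq0 // intr_eq0.
by move: n0; rewrite /lexle xpair_eqE /sgnZ2 /= expr1; lia.
Qed.

Lemma aut_neq0 sigma x : x != 0 -> exists k, (sigma x)@_k != 0.
Proof.
move=> x0; have [sl [tau sK _] _] := is_lie_autP sigma.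
apply/not_existsP => h; case/eqP: x0; apply: (can_inj sK).
have -> : sigma 0 = 0 by rewrite -[X in sigma X](scale0r 0) lieAutZ scale0r.
by apply/malgP => k; rewrite mcoeff0; apply/eqP/negPn/negP/h.
Qed.

(** On B_b the operator ad L_{0,0} is the scalar b q, and ad (c L_{0,0}) is the
    scalar c a q on B_a; an automorphism must match the eigenvalues. *)
Lemma aut_eigen sigma c b j a i :
  sigma (blockL 0 0) = c *: blockL 0 0 ->
  (sigma (blockL b j))@_(a, i) != 0 -> c * a%:~R = b%:~R.
Proof.
move=> s0 nz; have [sl _ sm] := is_lie_autP sigma.
have e : lieb (blockL 0 0 : block) (blockL b j) = (b * q)%:~R *: blockL b j.
  rewrite lieb_blockL mul0r subr0 add0r add0n; reflexivity.
have := congr1 (fun x => (sigma x)@_(a, i)) e.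
rewrite sm s0 (linearZE (lieb_linearl _)) lieAutZ !mcoeffZ lieb_L00 mulrA.
move=> /(mulIf nz); rewrite !intrM mulrA.
by apply: mulIf; rewrite intr_eq0; lia.
Qed.

Lemma aut_L00 sigma : exists2 s : int, s = 1 \/ s = -1 &
  sigma (blockL 0 0) = s%:~R *: blockL 0 0.
Proof.
have ex (tau : lieAut block) : exists c, tau (blockL 0 0 : block) = c *: blockL 0 0.
  exists (tau (blockL 0 0))@_(0, 0%N); apply: ad_locally_finiteP.
  exact/ad_locally_finite_aut/ad_locally_finite_L00.
have L0 a i : (blockL a i : block) != 0.
  by apply/eqP => /malgP/(_ (a, i))/eqP; rewrite mcoeffU eqxx mcoeff0 oner_eq0.
have [c cE] := ex sigma; have [d dE] := ex (sigma^-1)%g.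
have cd : c * d = 1.
  have := congr1 (sigma^-1)%g cE; rewrite lieAutZ dE scalerA.
  rewrite -[X in X = _](lieAutME _ sigma) mulVg => /malgP/(_ (0, 0%N)).
  by rewrite mcoeffZ mcoeffU eqxx mulr1.
(* The eigenvalue q on B_1 forces both c and its inverse to be integers. *)
have [[a i] /(aut_eigen cE) ca] := aut_neq0 sigma (L0 1 0%N).
have [[b j] /(aut_eigen dE) db] := aut_neq0 (sigma^-1)%g (L0 1 0%N).
have bc : c = b%:~R.
  by have := congr1 ( *%R c) db; rewrite mulrA cd mul1r mulr1 => ->.
exists b; last exact: etrans cE (congr1 ( *:%R^~ _) bc).
have : a * b == 1 by rewrite -(eqr_int K) mulrC intrM -bc ca.
by move=> /eqP/intUnitRing.unitzPl; rewrite qualifE /= => /orP[]/eqP; [left|right].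
Qed.

End ImageL00.

(** * The bracket on polynomials *)

Lemma poly_linear_ext (K : nzRingType) (V : lmodType K) (F G : {poly K} -> V) :
  linear F -> linear G -> (forall i, F 'X^i = G 'X^i) -> F =1 G.
Proof.
move=> Fl Gl FG f.
pose F' : {linear {poly K} -> V} :=
  HB.pack F (GRing.isLinear.Build _ _ _ _ F Fl).
pose G' : {linear {poly K} -> V} :=
  HB.pack G (GRing.isLinear.Build _ _ _ _ G Gl).
rewrite -[F]/(F' : _ -> _) -[G]/(G' : _ -> _) -[f]coefK poly_def !linear_sum.
by apply: eq_bigr => i _; rewrite !linearZ /= FG.
Qed.

Section PolynomialModel.
Variables (K : numFieldType) (q : nat).
Local Notation block := (block K q).
Implicit Types (f g : {poly K}) (a b : int) (x : block).

(** The Euler operator X d/dX shifted by q: it multiplies X^i by i + q, the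
    factor attached to the second index in the structure constants. *)
Definition eulerq f : {poly K} := q%:R *: f + 'X * f^`().

Lemma coef_eulerq f i : (eulerq f)`_i = (i + q)%:R * f`_i.
Proof.
rewrite coefD coefZ coefXM coef_deriv -mulr_natl natrD.
by case: i => [|i] /=; ring.
Qed.

Lemma eulerq_linear : linear eulerq.
Proof.
by move=> c u v; apply/polyP => i; rewrite coef_eulerq 2!coefD !coefZ !coef_eulerq; ring.
Qed.

HB.instance Definition _ := GRing.isLinear.Build K {poly K} {poly K} _ eulerq
  eulerq_linear.

Lemma eulerqXn i : eulerq 'X^i = (i + q)%:R *: 'X^i.
Proof.
apply/polyP => j; rewrite coef_eulerq coefZ coefXn.
by case: eqP => [->|]; rewrite ?mulr0.
Qed.

Lemma eulerqM f g : eulerq f * g + f * eulerq g = eulerq (f * g) + q%:R *: (f * g).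
Proof. by rewrite /eulerq derivM -!mul_polyC; ring. Qed.

Definition poly_block a f : block := \sum_(i < size f) f`_i *: blockL a i.

Lemma poly_block_coeff a f b i : (poly_block a f)@_(b, i) = if a == b then f`_i else 0.
Proof.
rewrite raddf_sum /=; under eq_bigr do rewrite mcoeffZ mcoeffU xpair_eqE.
case: eqP => _ /=; last by rewrite big1 // => j _; rewrite mulr0.
have [si|si] := leqP (size f) i.
  rewrite nth_default // big1 // => j _.
  by rewrite ltn_eqF ?mulr0 // (leq_trans (ltn_ord j)).
rewrite (bigD1 (Ordinal si)) //= eqxx mulr1 big1 ?addr0 // => j.
by rewrite -val_eqE => /negPf /= ->; rewrite mulr0.
Qed.

Lemma poly_block_linear a : linear (poly_block a).
Proof.
move=> c u v; apply/malgP => -[b i]; rewrite mcoeffD mcoeffZ !poly_block_coeff.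
by case: eqP; rewrite ?coefD ?coefZ // mulr0 addr0.
Qed.

Lemma poly_block_Xn a i : poly_block a 'X^i = blockL a i.
Proof.
apply/malgP => -[b j]; rewrite poly_block_coeff coefXn mcoeffU xpair_eqE eq_sym.
by rewrite (eq_sym i) eq_sym; case: eqP.
Qed.

(** The identification of each B_a with K[X] turns the structure constants
    b (i + q) - a (j + q) into a first order bidifferential operator. *)
Lemma lieb_poly_block a b f g : lieb (poly_block a f) (poly_block b g) =
  poly_block (a + b) (b%:~R *: (eulerq f * g) - a%:~R *: (f * eulerq g)).
Proof.
move: f; apply: poly_linear_ext.
- by move=> c u v; rewrite poly_block_linear lieb_linearl.
- move=> c u v; rewrite -poly_block_linear eulerq_linear -!mul_polyC.
  by congr poly_block; ring.
move=> i; move: g; apply: poly_linear_ext.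
- by move=> c u v; rewrite poly_block_linear lieb_linearr.
- move=> c u v; rewrite -poly_block_linear eulerq_linear -!mul_polyC.
  by congr poly_block; ring.
move=> j; rewrite !poly_block_Xn lieb_blockL -poly_block_Xn -(linearZE (@poly_block_linear _)).
rewrite !eulerqXn -!mul_polyC exprD !rmorphB /= !rmorphM /=.
by congr poly_block; ring.
Qed.

Definition weight_poly a x : {poly K} :=
  linext (fun k : int * nat => if k.1 == a then 'X^(k.2) else 0) x.

Lemma weight_poly_linear a : linear (weight_poly a).
Proof. exact: linext_linear. Qed.

Lemma coef_weight_poly a x i : (weight_poly a x)`_i = x@_(a, i).
Proof.
have fl : linear (fun x => (weight_poly a x)`_i : K^o).
  by move=> c u v; rewrite weight_poly_linear coefD coefZ.
have gl : linear (fun x : block => x@_(a, i) : K^o).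
  by move=> c u v; rewrite mcoeffD mcoeffZ.
apply: (block_ext fl gl) => b j; rewrite /weight_poly linextU mcoeffU xpair_eqE /=.
by case: eqP => _; rewrite ?coefXn ?coef0 // eq_sym.
Qed.

End PolynomialModel.

(** * Automorphisms in polynomial form *)

Section PolynomialAutomorphism.
Variables (K : numFieldType) (q : nat).
Hypothesis q_gt0 : (0 < q)%N.
Local Notation D := (@eulerq K q).
Variable A : int -> {poly K} -> {poly K}.
Hypotheses (A_lin : forall a, linear (A a))
  (A_br : forall a b f g,
    A (a + b) (b%:~R *: (D f * g) - a%:~R *: (f * D g)) =
    b%:~R *: (D (A a f) * A b g) - a%:~R *: (A a f * D (A b g)))
  (A01 : A 0 1 = 1)
  (A1X : A 1 'X != 0).

Let AZ a c f : A a (c *: f) = c *: A a f. Proof. exact: linearZE. Qed.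

Let D_inj : injective D.
Proof.
move=> f g fg; apply/polyP => i; have := congr1 (fun p : {poly K} => p`_i) fg.
by rewrite !coef_eulerq; apply: mulfI; rewrite pnatr_eq0; lia.
Qed.

Let D1 : D 1 = q%:R *: 1. Proof. exact: (@eulerqXn K q 0). Qed.
Let DX : D 'X = q.+1%:R *: 'X. Proof. exact: (@eulerqXn K q 1). Qed.
Let DC c : D c%:P = (q%:R * c)%:P.
Proof.
apply/polyP => i; rewrite coef_eulerq !coefC.
by case: i => [|i]; rewrite ?mulr0.
Qed.

(** With h the product, the bracket of 1 in B_a with 1 in B_{-a} says
    2 q h + X h' = 2 q; the coefficients of h are then those of 1 because
    k + 2 q never vanishes. *)
Lemma A1_mul_A1N a : a != 0 -> A a 1 * A (- a) 1 = 1.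
Proof.
move=> a0; have := A_br a (- a) 1 1; rewrite addrN mulr1 mul1r D1 -scalerBl !AZ A01.
have -> : forall u v : {poly K}, (- a)%:~R *: u - a%:~R *: v = - a%:~R *: (u + v).
  by move=> u v; rewrite rmorphN scalerDr !scaleNr.
rewrite eulerqM; set h := _ * _ => e.
apply/polyP => k; have := congr1 (fun p : {poly K} => p`_k) e.
rewrite !coefZ coefD coef_eulerq coefZ coef1 => e'.
have a0' : - a%:~R != 0 :> K by rewrite oppr_eq0 intr_eq0.
apply: (@mulfI _ ((k + q)%:R + q%:R)); first by rewrite -natrD pnatr_eq0; lia.
apply: (mulfI a0'); rewrite [in LHS]mulrDl -e'.
by case: k {e e'} => [|k]; rewrite ?mulr0 // add0n; ring.
Qed.

Let g a : K := (A a 1)`_0.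

Lemma A1_constant a : A a 1 = (g a)%:P.
Proof.
have [->|a0] := eqVneq a 0; first by rewrite /g A01 coef1.
have /eqP := congr1 (fun p : {poly K} => size p) (A1_mul_A1N a0).
by rewrite size_poly1 size_mul_eq1 => /andP[/eqP/eq_leq/size1_polyC].
Qed.

Lemma g0 : g 0 = 1. Proof. by rewrite /g A01 coef1. Qed.

Lemma gM a : g a * g (- a) = 1.
Proof.
have [->|a0] := eqVneq a 0; first by rewrite oppr0 g0 mulr1.
by apply: (@polyC_inj K); rewrite polyCM -!A1_constant A1_mul_A1N.
Qed.

Lemma g_neq0 a : g a != 0.
Proof. by apply/eqP => e; have /eqP := gM a; rewrite e mul0r eq_sym oner_eq0. Qed.

Let nu := (A 0 'X)`_1.

(** Let v = A_0 X.  The bracket of X in B_0 with 1 in B_{-1} expresses A_{-1} X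
    through D v (e1); substituting this in the bracket of 1 in B_1 with X in
    B_{-1} (e2) yields (D + q) D v = (q + 1) (2 q + 1) v.  On coefficients this
    reads (k - 1) (k + 1 + 3 q) v_k = 0, which leaves only v_1. *)
Lemma A0X : A 0 'X = nu *: 'X.
Proof.
have e1 : q.+1%:R *: A (-1) 'X = g (-1) *: D (A 0 'X).
  have := A_br 0 (-1) 'X 1; rewrite add0r DX mulr1 !scale0r !subr0 scalerA AZ.
  rewrite A1_constant [_ * _%:P]mulrC mul_polyC -scalerA.
  by apply: scalerI; rewrite intr_eq0.
have := congr1 ( *:%R q.+1%:R) (A_br 1 (-1) 1 'X).
rewrite addrN D1 DX -scalerAl !mul1r A1_constant DC scalerBr !scale1r.
rewrite scalerA -scalerBl AZ !scalerA mul_polyC => e2.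
apply/polyP => k; rewrite coefZ coefX.
have := congr1 (fun p : {poly K} => p`_k) e1.
have := congr1 (fun p : {poly K} => p`_k) e2.
rewrite coefB !(coefZ, coefCM) !coef_eulerq.
have [->|k1] := eqVneq k 1%N; rewrite ?mulr1 // mulr0.
set v := (A 0 'X)`_k; set w := (A (-1) 'X)`_k => {}e2 {}e1.
apply/eqP; have : (k%:R - 1) * (k + 1 + 3 * q)%:R * v = 0.
  transitivity (g 1 * (k + 2 * q)%:R * (g (-1) * ((k + q)%:R * v))
                - (2 * q).+1%:R * q.+1%:R * v).
    rewrite !mulrA [g 1 * _ * g _]mulrAC gM; ring.
  rewrite -e1; apply/eqP; rewrite subr_eq0; apply/eqP.
  transitivity (- (q.+1%:R * (-1)%:~R * (q%:R * g 1 * w) -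
                   q.+1%:R * (g 1 * ((k + q)%:R * w)))); first by ring.
  by rewrite -e2; ring.
move/eqP; rewrite !mulf_eq0 subr_eq0 pnatr_eq1 (negPf k1) pnatr_eq0 /=.
by rewrite addnAC addn1.
Qed.

(** Bracketing with X in B_0 makes A_a linear over K[X], up to the
    substitution of nu X for X. *)
Lemma AXM a f : a != 0 -> A a ('X * f) = nu *: ('X * A a f).
Proof.
move=> a0; have a0' : a%:~R * q.+1%:R != 0 :> K.
  by rewrite mulf_neq0 ?intr_eq0 ?pnatr_eq0.
apply: (scalerI a0'); have := A_br 0 a 'X f.
rewrite add0r !scale0r !subr0 A0X DX linearZ /= DX -!scalerAl !AZ !scalerA.
by rewrite -mulrA [_ * nu]mulrC.
Qed.

Lemma AXn_neq0 a i : a != 0 -> A a 'X^i = (g a * nu ^+ i) *: 'X^i.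
Proof.
move=> a0; elim: i => [|i IH].
  by rewrite expr0 mulr1 A1_constant -alg_polyC.
by rewrite exprS AXM // IH -scalerAr scalerA exprS; congr (_ *: _); ring.
Qed.

(** On B_0 the bracket with B_0 is trivial, so A_0 is recovered through its
    action on B_1, and D is injective. *)
Lemma A0Xn i : A 0 'X^i = nu ^+ i *: 'X^i.
Proof.
apply: D_inj; have := A_br 0 1 'X^i 1.
rewrite add0r !scale0r !subr0 !scale1r eulerqXn mulr1 AZ AXn_neq0 //.
rewrite A1_constant [RHS]mulrC mul_polyC scalerA mulrCA -scalerA => /(scalerI (g_neq0 1)) <-.
by rewrite linearZ /= eulerqXn scalerA mulrC.
Qed.

Lemma AXn a i : A a 'X^i = (g a * nu ^+ i) *: 'X^i.
Proof.
by have [->|a0] := eqVneq a 0; [rewrite A0Xn g0 mul1r | rewrite AXn_neq0].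
Qed.

Lemma AX a : A a 'X = (g a * nu) *: 'X.
Proof. exact: (AXn a 1). Qed.

Lemma nu_neq0 : nu != 0.
Proof. by apply: contraNneq A1X => e; rewrite AX e mulr0 scale0r. Qed.

(** Bracketing X, and not 1, in B_1 with 1 in B_a gives the recurrence without
    exception: its structure constant a (q + 1) - q has no integer root, whereas
    the one of 1 and 1, namely (a - 1) q, vanishes at a = 1. *)
Lemma gS (a : int) : g (a + 1) = g 1 * g a.
Proof.
have := A_br 1 a 'X 1.
rewrite D1 DX -scalerAr !mulr1 !scalerA mul1r -scalerBl AZ !AX A1_constant DC.
rewrite (linearZE (@eulerq_linear K q)) DX => /(congr1 (fun p : {poly K} => p`_1)).
rewrite coefB !(coefZ, coefMC) coefX !mulr1 [1 + a]addrC => e.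
have c0 : (a%:~R * q.+1%:R - q%:R) * nu != 0.
  rewrite mulf_neq0 ?nu_neq0 //.
  have -> : a%:~R * q.+1%:R - q%:R = (a * q.+1%:Z - q%:Z)%:~R :> K.
    by rewrite rmorphB rmorphM.
  by rewrite intr_eq0; apply/eqP; case: (lerP a 0) => ?; nia.
apply: (mulfI c0); rewrite -mulrA [nu * _]mulrC e; ring.
Qed.

Lemma gE a : g a = g 1 ^ a.
Proof.
have g1 := g_neq0 1.
elim: a => [|n IH|n IH]; first by rewrite g0.
  by rewrite -addn1 PoszD gS IH expfzDr // expr1z mulrC.
apply: (mulfI g1); rewrite -gS -[X in X * _ ^ _]expr1z -expfzDr //.
have -> : - n.+1%:Z + 1 = - n%:Z by lia.
by rewrite IH; congr (_ ^ _); lia.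
Qed.

Lemma poly_aut_normal_form : exists2 munu : K * K, munu.1 != 0 /\ munu.2 != 0 &
  forall a i, A a 'X^i = (munu.1 ^ a * munu.2 ^+ i) *: 'X^i.
Proof.
exists (g 1, nu); first by split; [apply: g_neq0 | apply: nu_neq0].
by move=> a i; rewrite AXn gE.
Qed.

End PolynomialAutomorphism.

(** * The automorphism group *)

Section AutomorphismGroup.
Variables (K : numFieldType) (q : nat).
Hypothesis q_gt0 : (0 < q)%N.
Local Notation block := (block K q).
Implicit Types (sigma tau : lieAut block).

(** Fixing L_{0,0} means commuting with ad L_{0,0}, hence preserving its
    eigenspaces B_a; the action on them is the family A of polynomial maps. *)
Lemma aut_fix_L00 tau : tau (blockL 0 0) = blockL 0 0 ->
  exists mu nu : K, [/\ mu != 0, nu != 0 &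
    forall a i, tau (blockL a i) = (mu ^ a * nu ^+ i) *: blockL a i].
Proof.
move=> t0; have [tl tb tm] := is_lie_autP tau.
pose A a f := weight_poly a (tau (poly_block q a f)).
have AE a f : tau (poly_block q a f) = poly_block q a (A a f).
  apply/malgP => -[b i]; rewrite poly_block_coeff coef_weight_poly.
  case: eqP => [->//|ab]; apply/eqP/negPn/negP.
  move=> /(linear_coeff_neq0 tl)[[c j]]; rewrite poly_block_coeff.
  have [<- _ nz|_] := eqVneq a c; last by rewrite eqxx.
  apply: ab.
  have t0' : tau (blockL 0 0) = 1 *: blockL 0 0 by rewrite scale1r.
  by have /eqP := aut_eigen q_gt0 t0' nz; rewrite mul1r eqr_int => /eqP <-.
have A_lin a : linear (A a).
  by move=> c u v; rewrite /A poly_block_linear tl weight_poly_linear.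
have pK a : cancel (@poly_block K q a) (weight_poly a).
  by move=> f; apply/polyP => i; rewrite coef_weight_poly poly_block_coeff eqxx.
have A_br a b f g :
    A (a + b) (b%:~R *: (eulerq q f * g) - a%:~R *: (f * eulerq q g)) =
    b%:~R *: (eulerq q (A a f) * A b g) - a%:~R *: (A a f * eulerq q (A b g)).
  by rewrite [LHS]/A -lieb_poly_block tm !AE lieb_poly_block pK.
have A01 : A 0 1 = 1.
  by rewrite /A -(expr0 'X) poly_block_Xn t0 -poly_block_Xn pK.
have A1X : A 1 'X != 0.
  have X0 : poly_block q 1 ('X : {poly K}) != 0.
    apply/eqP => /malgP/(_ (1, 1%N)).
    by rewrite poly_block_coeff eqxx coefX mcoeff0 => /eqP; rewrite oner_eq0.
  have [[b i]] := aut_neq0 tau X0; rewrite AE poly_block_coeff.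
  by apply: contraNneq => ->; rewrite coef0 if_same.
have [[mu nu] /= [mu0 nu0] AXE] := poly_aut_normal_form q_gt0 A_lin A_br A01 A1X.
exists mu, nu; split=> // a i.
by rewrite -poly_block_Xn AE AXE (linearZE (@poly_block_linear _ _ _)).
Qed.

Lemma aut_normal_form sigma : exists (mu nu : K) (k : 'Z_2),
  [/\ mu != 0, nu != 0 & forall a i, sigma (blockL a i) =
     ((sgnZ2 k)%:~R * mu ^ a * nu ^+ i) *: blockL (sgnZ2 k * a) i].
Proof.
have [s sE s0] := aut_L00 q_gt0 sigma.
have [k kE] : exists k, sgnZ2 k = s.
  by case: sE => ->; [exists 0 | exists 1].
have t0 : (sigma * delta K q k)%g (blockL 0 0) = blockL 0 0.
  rewrite lieAutME deltaL mulr0 lieAutZ s0 scalerA -kE -intrM sgnZ2_sqr.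
  by rewrite scale1r.
have [mu [nu [mu0 nu0 tE]]] := aut_fix_L00 t0.
(* In sigma = tau * delta the parameter mu meets the index s a, so it is
   mu ^ s that gets raised to the power a. *)
exists (mu ^ sgnZ2 k), nu, k; split=> [||a i].
- exact: expfz_neq0.
- exact: nu0.
have -> : blockL a i = (sgnZ2 k)%:~R *: delta K q k (blockL (sgnZ2 k * a) i).
  by rewrite deltaL scalerA -intrM mulrA sgnZ2_sqr mul1r scale1r.
rewrite lieAutZ; have := tE (sgnZ2 k * a) i; rewrite lieAutME => ->.
rewrite scalerA mulrA exprz_exp; reflexivity.
Qed.

Local Notation Kstar := (fieldUnits K).

Definition aut_of (u : semidirect (block_act K)) : lieAut block :=
  (theta q u.1.1 * eta q u.1.2 * delta K q u.2)%g.

Lemma aut_ofL u a i : aut_of u (blockL a i) =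
  ((sgnZ2 u.2)%:~R * (fuval u.1.1 ^ (sgnZ2 u.2 * a) * fuval u.1.2 ^+ i)) *:
  blockL (sgnZ2 u.2 * a) i.
Proof.
rewrite /aut_of !lieAutME deltaL !lieAutZ etaL lieAutZ thetaL !scalerA.
by rewrite -mulrA [_ ^+ _ * _]mulrC.
Qed.

Lemma lieAut_blockP sigma tau :
  (forall a i, sigma (blockL a i) = tau (blockL a i)) -> sigma = tau.
Proof.
move=> e; apply: lieAutP; apply: block_ext => //.
- by have [] := is_lie_autP sigma.
- by have [] := is_lie_autP tau.
Qed.

Lemma sgnZ2M (k l : 'Z_2) : sgnZ2 (k * l)%g = sgnZ2 k * sgnZ2 l.
Proof. by case: k l => [[|[|//]] h] [[|[|//]] h']. Qed.

Lemma sgnZ2_inj : injective sgnZ2.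
Proof.
by move=> [[|[|//]] h] [[|[|//]] h'] // _; apply: val_inj.
Qed.

Lemma block_act_fun1 (k : 'Z_2) (x : Kstar * Kstar) :
  fuval (block_act_fun k x).1 = fuval x.1 ^ sgnZ2 k.
Proof. by case: k => [[|[|//]] h]. Qed.

Lemma aut_ofM : {morph aut_of : u v / (u * v)%g}.
Proof.
move=> u v; apply: lieAut_blockP => a i.
rewrite [LHS]aut_ofL [RHS](lieAutME (aut_of u) (aut_of v)) (aut_ofL v) lieAutZ.
rewrite (aut_ofL u) scalerA.
move: u v => [[m1 n1] k1] [[m2 n2] k2].
(* The product of the semidirect product is unfolded by conversion only, to keep
   the action opaque until its value m2 ^ s is substituted. *)
change (((m1, n1, k1) * (m2, n2, k2))%g : semidirect (block_act K)) with
  (((m1 * (block_act_fun k1 (m2, n2)).1, n1 * n2), k1 * k2)%g :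
     semidirect (block_act K)).
have := block_act_fun1 k1 (m2, n2).
move: (block_act_fun k1 (m2, n2)).1 => b bE; rewrite /= bE sgnZ2M /=.
clear bE.
move: (fuval m1) (fuval m2) (fuval n1) (fuval n2) => {}m1 {}m2 {}n1 {}n2.
move: (sgnZ2 k1) (sgnZ2_sqr k1) (sgnZ2 k2) => s1 ss s2.
rewrite expfzMl exprz_exp exprMn -!mulrA; congr (_ *: _).
have -> : s1 * (s1 * (s2 * a)) = s2 * a by rewrite mulrA ss mul1r.
rewrite intrM; ring.
Qed.

Lemma scale_blockL_coeff (c : K) a i p :
  (c *: (blockL a i : block))@_p = c * ((a, i) == p)%:R.
Proof. by rewrite mcoeffZ mcoeffU. Qed.

Lemma scale_blockL_inj (c d : K) a i b j : c != 0 ->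
  c *: (blockL a i : block) = d *: blockL b j -> (a, i) = (b, j) /\ c = d.
Proof.
move=> c0 e; have := scale_blockL_coeff c a i (a, i).
rewrite {}e scale_blockL_coeff eqxx mulr1 => /esym; have [<-|_] := eqVneq (b, j) (a, i).
  by rewrite mulr1.
by rewrite mulr0 => c1; rewrite c1 eqxx in c0.
Qed.

Lemma aut_of_inj : injective aut_of.
Proof.
move=> u v uv.
have s0 k : (sgnZ2 k)%:~R != 0 :> K.
  by rewrite intr_eq0; case: k => [[|[|//]] h].
have eL a i : (sgnZ2 u.2 * a, i) = (sgnZ2 v.2 * a, i) /\
    (sgnZ2 u.2)%:~R * (fuval u.1.1 ^ (sgnZ2 u.2 * a) * fuval u.1.2 ^+ i) =
    (sgnZ2 v.2)%:~R * (fuval v.1.1 ^ (sgnZ2 v.2 * a) * fuval v.1.2 ^+ i).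
  apply: scale_blockL_inj; last by rewrite -!aut_ofL uv.
  apply: mulf_neq0 (s0 _) _.
  exact: mulf_neq0 (expfz_neq0 _ (fuvalP _)) (expf_neq0 _ (fuvalP _)).
(* The index of the image of L_{1,0} reveals the sign. *)
(* The support of the image of L_{1,0} reveals the sign. *)
have kE : u.2 = v.2.
  by have [[+ _]] := eL 1 0%N; rewrite !mulr1; apply: sgnZ2_inj.
have eC a i : fuval u.1.1 ^ (sgnZ2 v.2 * a) * fuval u.1.2 ^+ i =
              fuval v.1.1 ^ (sgnZ2 v.2 * a) * fuval v.1.2 ^+ i.
  by have [_] := eL a i; rewrite kE; apply: (mulfI (s0 _)).
have mE : u.1.1 = v.1.1.
  apply: val_inj; have := eC (sgnZ2 v.2) 0%N.
  by rewrite sgnZ2_sqr !expr0 !mulr1.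
have nE : u.1.2 = v.1.2.
  by apply: val_inj; have := eC 0 1%N; rewrite mulr0 !mul1r.
by move: mE nE kE; case: u v {uv eL eC} => [[? ?] ?] [[? ?] ?] /= -> -> ->.
Qed.

Lemma aut_of_surj sigma : exists u, aut_of u = sigma.
Proof.
have [mu [nu [k [mu0 nu0 sE]]]] := aut_normal_form sigma.
exists ((FieldUnits (expfz_neq0 (sgnZ2 k) mu0), FieldUnits nu0), k).
apply: lieAut_blockP => a i; rewrite aut_ofL sE /=.
by rewrite exprz_exp mulrA sgnZ2_sqr mul1r mulrA.
Qed.

Lemma aut_of_iso : group_isomorphism aut_of.
Proof.
split; first exact: aut_ofM.
have [inv invK] := choice aut_of_surj.
by exists inv => // u; apply: aut_of_inj; rewrite invK.
Qed.

End AutomorphismGroup.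

Theorem theorem2p7 (R : realType) (q : nat) (q_gt0 : (0 < q)%N) :
  (forall sigma : lieAut (block R[i] q),
     exists (mu nu : R[i]) (s : int),
       [/\ mu != 0, nu != 0, s = 1 \/ s = -1 &
        forall (a : int) (i : nat),
          sigma (blockL a i) =
            (s%:~R * mu ^ a * nu ^+ i) *: blockL (s * a) i]) /\
  (exists Phi : semidirect (block_act R[i]) -> lieAut (block R[i] q),
     group_isomorphism Phi /\
     forall (mu nu : fieldUnits R[i]) (k : 'Z_2),
       Phi ((mu, nu), k) = (theta q mu * eta q nu * delta R[i] q k)%g).
Proof.
split=> [sigma|].
  have [mu [nu [k [mu0 nu0 sE]]]] := aut_normal_form q_gt0 sigma.
  exists mu, nu, (sgnZ2 k); split=> //.
  by case: k {sE} => [[|[|//]] h]; [left | right].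
by exists (@aut_of R[i] q); split; [exact: aut_of_iso|].
Qed.
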